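(* (1) The problem $\textsf{NIN}$ $N$-reduces to $\textsf{HBU}$. (2) Cantor's theorem $N$-reduces to $\textsf{HBU}$ restricted to functions $\Psi$ of Baire class $2$.
   Context: Work in the language of higher-order arithmetic: type $0$ objects are natural numbers, type $1$ elements of $\mathbb{N}^{\mathbb{N}}$, type $2$ functionals $\mathbb{N}^{\mathbb{N}}\to\mathbb{N}$. Reals are represented by elements of $\mathbb{N}^{\mathbb{N}}$ in the standard way so that quantifiers over $[0,1]$ are quantifiers over $\mathbb{N}^{\mathbb{N}}$; functions $[0,1]\to\mathbb{R}$ or $[0,1]\to\mathbb{N}$ are type-2 objects and subsets of $[0,1]$ are given by characteristic functions. A ''problem'' is a statement of the form $(\forall Y^{2})(\exists x^{1})A(Y,x)$ (with higher-type inputs coded as type-2 objects and outputs such as reals or finite sequences of reals coded as type-1 objects). For problems $P_A\equiv(\forall Y^{2})(\exists x^{1})A(Y,x)$ and $P_B\equiv(\forall Z^{2})(\exists y^{1})B(Z,y)$, $P_B$ $N$-reduces to $P_A$ if there are $e\in\mathbb{N}$ and terms $s$, $t$ of Gödel's system $T$ with $(\forall Z^{2},x^{1})\big[A(t(Z),x)\to[\{e\}^{s(Z,x)}\downarrow\wedge B(Z,\{e\}^{s(Z,x)})]\big]$, where $\{e\}^{X}$ is the $e$-th Turing machine with oracle $X$. $\textsf{NIN}$: there is no injection from $[0,1]$ to $\mathbb{N}$; as a problem: for every $Z:[0,1]\to\mathbb{N}$ there are $x,y\in[0,1]$ with $x\neq y$ and $Z(x)=Z(y)$. Cantor's theorem: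 for every set $A\subseteq[0,1]$ and every $Y:[0,1]\to\mathbb{N}$ that is injective on $A$, there is $x\in[0,1]\setminus A$. $\textsf{HBU}$: for every $\Psi:[0,1]\to\mathbb{R}^{+}$ there are $x_0,\dots,x_k\in[0,1]$ with $[0,1]\subseteq\bigcup_{i\leq k}B(x_i,\Psi(x_i))$, $B(x,r)$ the open ball. Its restriction to Baire class $2$ functions asserts this only for $\Psi$ of Baire class $2$ (pointwise limits of sequences of Baire class $1$ functions, these being pointwise limits of sequences of continuous functions). *)

(* Defs.v *)
From Stdlib Require Cantor.
From HB Require Import structures.
From mathcomp Require Import all_boot all_order all_algebra.
From mathcomp Require Import all_classical all_reals all_analysis.

Set Implicit Arguments.
Unset Strict Implicit.
Unset Printing Implicit Defensive.

Import Order.TTheory GRing.Theory Num.Theory.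
Import numFieldNormedType.Exports.

Local Open Scope classical_set_scope.
Local Open Scope ring_scope.

Definition type1 : Type := nat -> nat.
Definition type2 : Type := type1 -> nat.

(** * Goedel's system T *)

Inductive ty : Type := Nat | Arr of ty & ty.

(* Full (set-theoretic) type structure over nat. *)
Fixpoint den (a : ty) : Type :=
  if a is Arr b c then den b -> den c else nat.

Inductive var : seq ty -> ty -> Type :=
| VZ G a : var (a :: G) a
| VS G a b : var G a -> var (b :: G) a.

(* Intrinsically typed lambda-terms with de Bruijn indices. *)
Inductive term : seq ty -> ty -> Type :=
| Var G a : var G a -> term G a
| Lam G a b : term (a :: G) b -> term G (Arr a b)
| App G a b : term G (Arr a b) -> term G a -> term G b
| Zero G : term G Nat
| Succ G : term G (Arr Nat Nat)
| Rec G a : term G (Arr a (Arr (Arr Nat (Arr a a)) (Arr Nat a))).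

Fixpoint env (G : seq ty) : Type :=
  if G is a :: G' then (den a * env G')%type else unit.

Fixpoint lookup_var G a (v : var G a) : env G -> den a :=
  match v in var G a return env G -> den a with
  | VZ _ _ => fun rho => rho.1
  | VS _ _ _ w => fun rho => lookup_var w rho.2
  end.

Fixpoint eval G a (t : term G a) : env G -> den a :=
  match t in term G a return env G -> den a with
  | Var _ _ v => fun rho => lookup_var v rho
  | Lam _ _ _ u => fun rho x => eval u (x, rho)
  | App _ _ _ u v => fun rho => (eval u rho) (eval v rho)
  | Zero _ => fun=> 0%N
  | Succ _ => fun=> S
  | Rec _ a => fun=> fun (z : den a) (f : nat -> den a -> den a) =>
      fix rec (n : nat) : den a := if n is n'.+1 then f n' (rec n') else z
  end.

Definition interp a (t : term [::] a) : den a := eval t tt.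

Definition Ty1 : ty := Arr Nat Nat.
Definition Ty2 : ty := Arr Ty1 Nat.

(** * Oracle Turing machines *)

Inductive move : Type := MoveLeft | Stay | MoveRight.

Definition move_code (d : move) : option bool :=
  match d with MoveLeft => Some false | Stay => None | MoveRight => Some true end.
Definition move_decode (o : option bool) : move :=
  match o with
  | Some false => MoveLeft | None => Stay | Some true => MoveRight
  end.
Lemma move_codeK : cancel move_code move_decode. Proof. by case. Qed.
HB.instance Definition _ := Countable.copy move (can_type move_codeK).

(* A two-way infinite tape over {blank = false, 1 = true}; cells beyond the two
   lists are blank, and both lists start next to the head. *)
Record tape : Type := Tape { lft : seq bool; cur : bool; rgt : seq bool }.

Definition write (b : bool) (t : tape) : tape := Tape (lft t) b (rgt t).

Definition shift (d : move) (t : tape) : tape :=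
  match d with
  | MoveLeft => Tape (behead (lft t)) (head false (lft t)) (cur t :: rgt t)
  | Stay => t
  | MoveRight => Tape (cur t :: lft t) (head false (rgt t)) (behead (rgt t))
  end.

(* The head scans the leftmost of n consecutive 1s. *)
Definition unary (n : nat) : tape := Tape [::] (0 < n)%N (nseq n.-1 true).

Definition ones (t : tape) : nat :=
  (count id (lft t) + cur t + count id (rgt t))%N.

(* ((q, (a, b)), (q', (a', b'), (d, d'))): in state q, scanning a on the work
   tape and b on the query tape, write a' and b', move the two heads by d and
   d', and enter state q'. *)
Definition instr : Type :=
  ((nat * (bool * bool)) * (nat * (bool * bool) * (move * move)))%type.

Definition program : Type := seq instr.

Record config : Type := Config { state : nat; work : tape; query : tape }.

Definition start_state : nat := 0%N.
Definition query_state : nat := 1%N.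
Definition answer_state : nat := 2%N.

(* In query_state the machine replaces the number m on the query tape by X m.
   In other states it obeys the first applicable instruction, and it halts
   (None) when there is none. *)
Definition step (p : program) (X : type1) (c : config) : option config :=
  if state c == query_state then
    Some (Config answer_state (work c) (unary (X (ones (query c)))))
  else
    omap
      (fun i : instr =>
         let: (q, (a, b), (d, d')) := i.2 in
         Config q (shift d (write a (work c))) (shift d' (write b (query c))))
      (ohead [seq i <- p
               | i.1 == (state c, (cur (work c), cur (query c)))]).

Definition init (n : nat) : config := Config start_state (unary n) (unary 0).

Definition run (p : program) (X : type1) (k : nat) (c : config) : config :=
  iter k (fun c => odflt c (step p X c)) c.

(* pickle is an effective, injective numbering of programs; numbers that code no
   program are assigned the empty one. *)
Definition machine (e : nat) : program := odflt [::] (unpickle e).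

(* {e}^X(n) = m *)
Definition computes (e : nat) (X : type1) (n m : nat) : Prop :=
  exists k : nat, let c := run (machine e) X k (init n) in
    step (machine e) X c = None /\ ones (work c) = m.

(** * Problems and N-reduction *)

(* The problem (forall Y^2)(exists x^1) A(Y, x) is given by its matrix A. *)
Definition problem : Type := type2 -> type1 -> Prop.

(* {e}^X as a type 1 object converges when it is total; y below is {e}^X. *)
Definition N_reduces (B A : problem) : Prop :=
  exists (e : nat) (s : term [::] (Arr Ty2 (Arr Ty1 Ty1)))
         (t : term [::] (Arr Ty2 Ty2)),
    forall (Z : type2) (x : type1),
      A (interp t Z) x ->
      exists y : type1,
        (forall n, computes e (interp s Z x) n (y n)) /\ B Z y.

(** * Representation of reals and of functions on the unit interval *)

(* The code <n, m> stands for (n/2)/(m+1) if n is even and for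
   -((n+1)/2)/(m+1) if n is odd. *)
Definition rat_of_code (c : nat) : rat :=
  let: (n, m) := Cantor.of_nat c in
  (if odd n then - (uphalf n)%:R else (n./2)%:R) / (m.+1)%:R.

Definition fast_cauchy (x : type1) : Prop :=
  forall n i : nat,
    `|rat_of_code (x n) - rat_of_code (x (n + i)%N)| < (2 ^+ n)^-1.

Definition cons_fun (n : nat) (x : type1) : type1 :=
  fun k => if k is k'.+1 then x k' else n.

(* The n-th component of a sequence of type 2 objects coded by one of them. *)
Definition section (Y : type2) (n : nat) : type2 := fun x => Y (cons_fun n x).

Section Representations.
Variable R : realType.

Definition represents (x : type1) (r : R) : Prop :=
  fast_cauchy x /\ (ratr (rat_of_code (x n)) : R) @[n --> \oo] --> r.

(* Functions on [0,1] are total functions on R of which only the values on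
   [0,1] matter. *)
Definition codes_nat_fun (Y : type2) (g : R -> nat) : Prop :=
  forall (x : type1) (r : R), r \in `[0, 1] -> represents x r -> Y x = g r.

Definition codes_set (Y : type2) (A : set R) : Prop :=
  codes_nat_fun Y (fun r => nat_of_bool (r \in A)).

(* A map N^N -> N^N is coded by Y with (F x) n = Y (n, x 0, x 1, ...). *)
Definition codes_real_fun (Y : type2) (f : R -> R) : Prop :=
  forall (x : type1) (r : R), r \in `[0, 1] -> represents x r ->
    represents (fun n => section Y n x) (f r).

(* Baire classes of functions on [0,1]. *)
Fixpoint baire_class (n : nat) (f : R -> R) : Prop :=
  if n is n'.+1 then
    exists g : nat -> R -> R,
      (forall k, baire_class n' (g k)) /\
      (forall r : R, r \in `[0, 1] -> g k r @[k --> \oo] --> f r)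
  else {within `[0, 1], continuous f}.

(* w codes the nonempty finite sequence of reals p 0, ..., p k. *)
Definition codes_points (w : type1) (k : nat) (p : nat -> R) : Prop :=
  w 0%N = k /\
  forall i, (i <= k)%N -> represents (fun n => w (Cantor.to_nat (i, n)).+1) (p i).

Definition covering (Psi : R -> R) (w : type1) : Prop :=
  exists (k : nat) (p : nat -> R),
    [/\ codes_points w k p,
        forall i, (i <= k)%N -> p i \in `[0, 1] &
        `[0, 1] `<=` \bigcup_(i in [set i | (i <= k)%N]) ball (p i) (Psi (p i))].

Definition positive_on_unit (Psi : R -> R) : Prop :=
  forall r : R, r \in `[0, 1] -> 0 < Psi r.

Definition HBU : problem := fun Y w =>
  forall Psi, codes_real_fun Y Psi -> positive_on_unit Psi -> covering Psi w.

Definition HBU_Baire2 : problem := fun Y w =>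
  forall Psi, codes_real_fun Y Psi -> positive_on_unit Psi ->
    baire_class 2 Psi -> covering Psi w.

(* The two reals are interleaved in y. *)
Definition NIN : problem := fun Z y =>
  forall g, codes_nat_fun Z g ->
    exists r r' : R,
      [/\ represents (fun n => y n.*2) r /\ represents (fun n => y n.*2.+1) r',
          r \in `[0, 1], r' \in `[0, 1], r <> r' & g r = g r'].

(* The input codes the pair (A, g) by its sections 0 and 1. *)
Definition Cantor_thm : problem := fun Z y =>
  forall (A : set R) (g : R -> nat),
    A `<=` `[0, 1] -> codes_set (section Z 0) A ->
    codes_nat_fun (section Z 1) g ->
    (forall r r', A r -> A r' -> g r = g r' -> r = r') ->
    exists r : R, [/\ represents y r, r \in `[0, 1] & ~ A r].

End Representations.

(* Main.v *)
(** Both reductions rest on the fact that balls of radius 2^-(m+3), one for each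
    m, have total length 1/2 and so do not cover [0,1].

    For NIN, apply HBU to the radius 2^-(Z(x)+4). If any two points of the
    resulting finite cover with the same value m of Z were within 2^-(m+4) of
    each other, their balls would lie in one ball of radius 2^-(m+3), which is
    impossible. Hence two points with the same value m are apart by a distance
    bounded below in terms of m, so that a bounded search comparing rational
    approximations of known precision finds such a pair: it is carried out
    in system T, and the Turing machine only has to copy its oracle.

    For Cantor's theorem, use the radius 2^-(Y(x)+4) on A and 1 off A. If all the
    points of the cover were in A, injectivity of Y would give one ball for each
    m. A point of the cover outside A is found by evaluating the characteristic
    function of A. The radius is of Baire class 2, as the limit of functions that
    differ from a constant at finitely many points. *)

From Stdlib Require Cantor.
From mathcomp Require Import all_boot all_order all_algebra.
From mathcomp Require Import all_classical all_reals all_analysis.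
From mathcomp Require Import zify ring lra.
Require Import Defs.

Set Implicit Arguments.
Unset Strict Implicit.
Unset Printing Implicit Defensive.

Import Order.TTheory GRing.Theory Num.Theory.
Import numFieldNormedType.Exports.

Local Open Scope classical_set_scope.
Local Open Scope ring_scope.

(** * The oracle-copying machine *)

(** State 0 moves the unary input from the work tape to the query tape and enters [query_state] at
    the first blank. State 2 copies the answer onto the blank work tape and halts at the end of it,
    where no instruction applies. *)
Definition copy_program : program :=
  [:: ((0, (true, false)), (0, (false, true), (MoveRight, MoveRight)));
      ((0, (false, false)), (1, (false, false), (Stay, Stay)));
      ((2, (false, true)), (2, (true, true), (MoveRight, MoveRight)))]%N.

Lemma cat_nseq_cons (T : Type) n (x : T) s :
  nseq n x ++ x :: s = x :: nseq n x ++ s.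
Proof. by elim: n => //= n ->. Qed.

(** The left halves [L] and [Q] are arbitrary for the induction. The final head position is
    harmless, since [ones] counts over the whole tape. *)
Lemma run_copy_input X n L Q :
  run copy_program X n
    (Config 0 (Tape L (0 < n)%N (nseq n.-1 true)) (Tape Q false [::])) =
  Config 0 (Tape (nseq n false ++ L) false [::])
    (Tape (nseq n true ++ Q) false [::]).
Proof.
elim: n L Q => [|n IHn] L Q //.
rewrite /run iterSr /= -/(run copy_program X n _).
have -> : head false (nseq n true) = (0 < n)%N by case: n {IHn}.
have -> : behead (nseq n true) = nseq n.-1 true by case: n {IHn}.
by rewrite IHn !cat_nseq_cons.
Qed.

Lemma run_copy_answer X n L Q :
  run copy_program X n
    (Config 2 (Tape L false [::]) (Tape Q (0 < n)%N (nseq n.-1 true))) =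
  Config 2 (Tape (nseq n true ++ L) false [::])
    (Tape (nseq n true ++ Q) false [::]).
Proof.
elim: n L Q => [|n IHn] L Q //.
rewrite /run iterSr /= -/(run copy_program X n _).
have -> : head false (nseq n true) = (0 < n)%N by case: n {IHn}.
have -> : behead (nseq n true) = nseq n.-1 true by case: n {IHn}.
by rewrite IHn !cat_nseq_cons.
Qed.

Lemma computes_copy (X : type1) (n : nat) :
  computes (pickle copy_program) X n (X n).
Proof.
(* Read from the right: [n] steps move the input, one step enters [query_state], one step is the
   query, and [X n] steps copy the answer. *)
rewrite /computes /machine pickleK /=; exists (X n + 2 + n)%N.
rewrite /run iterD -/(run _ _ n _) run_copy_input iterD /=.
rewrite -/(run _ _ (X _) _) /ones /= !cats0 count_nseq /= mul1n !addn0.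
by rewrite run_copy_answer /= count_cat !count_nseq /= mul0n mul1n !addn0.
Qed.

(** * Arithmetic in system T *)

Local Notation "u $ v" := (App u v) (at level 20, left associativity).
Local Notation v0 := (Var (VZ _ _)).
Local Notation v1 := (Var (VS _ (VZ _ _))).
Local Notation v2 := (Var (VS _ (VS _ (VZ _ _)))).
Local Notation v3 := (Var (VS _ (VS _ (VS _ (VZ _ _))))).

(** This and the terms below exist in every context [G]. Each is made opaque after its evaluation
    lemma, so that [/=] stops at it and the lemma can rewrite it. *)
Fixpoint numeral G n : term G Nat :=
  if n is n'.+1 then Succ G $ numeral G n' else Zero G.

Lemma eval_numeral G rho n : eval (numeral G n) rho = n.
Proof. by elim: n => //= n ->. Qed.
Opaque numeral.

Definition TAdd G : term G (Arr Nat (Arr Nat Nat)) :=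
  Lam (Lam (Rec _ Nat $ v1 $ Lam (Lam (Succ _ $ v0)) $ v0)).

Lemma eval_add G rho m n : eval (TAdd G) rho m n = (m + n)%N.
Proof. by elim: n => [|n /= ->]; rewrite ?addn0 ?addnS. Qed.
Opaque TAdd.

Definition TPred G : term G (Arr Nat Nat) :=
  Lam (Rec _ Nat $ Zero _ $ Lam (Lam v1) $ v0).

Lemma eval_pred G rho n : eval (TPred G) rho n = n.-1.
Proof. by case: n. Qed.
Opaque TPred.

Definition TSub G : term G (Arr Nat (Arr Nat Nat)) :=
  Lam (Lam (Rec _ Nat $ v1 $ Lam (Lam (TPred _ $ v0)) $ v0)).

Lemma eval_sub G rho m n : eval (TSub G) rho m n = (m - n)%N.
Proof. by elim: n => [|n /= ->]; rewrite ?subn0 // eval_pred subnS. Qed.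
Opaque TSub.

Definition TMul G : term G (Arr Nat (Arr Nat Nat)) :=
  Lam (Lam (Rec _ Nat $ Zero _ $ Lam (Lam (TAdd _ $ v3 $ v0)) $ v0)).

Lemma eval_mul G rho m n : eval (TMul G) rho m n = (m * n)%N.
Proof. by elim: n => [|n /= ->]; rewrite ?muln0 // eval_add mulnS. Qed.
Opaque TMul.

Definition TExp2 G : term G (Arr Nat Nat) :=
  Lam (Rec _ Nat $ numeral _ 1 $ Lam (Lam (TAdd _ $ v0 $ v0)) $ v0).

Lemma eval_exp2 G rho n : eval (TExp2 G) rho n = (2 ^ n)%N.
Proof. by elim: n => [|n /= ->] //; rewrite eval_add expnS mul2n addnn. Qed.
Opaque TExp2.

Definition TCond G : term G (Arr Nat (Arr Nat (Arr Nat Nat))) :=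
  Lam (Lam (Lam (Rec _ Nat $ v0 $ Lam (Lam v3) $ v2))).

Lemma eval_cond G rho c m n :
  eval (TCond G) rho c m n = if c == 0%N then n else m.
Proof. by case: c. Qed.
Opaque TCond.

(** With truncated subtraction, (m - n) + (n - m) vanishes exactly when m = n. *)
Definition TEq G : term G (Arr Nat (Arr Nat Nat)) :=
  Lam (Lam (TSub _ $ numeral _ 1 $
    (TAdd _ $ (TSub _ $ v1 $ v0) $ (TSub _ $ v0 $ v1)))).

Lemma eval_eq G rho m n : eval (TEq G) rho m n = (m == n).
Proof.
by rewrite /= eval_numeral eval_sub eval_add !eval_sub; case: eqP; lia.
Qed.
Opaque TEq.

(** Cantor's pairing: [n] plus the triangular number of [n + m], which the recursor computes. *)
Definition TPair G : term G (Arr Nat (Arr Nat Nat)) :=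
  Lam (Lam (TAdd _ $ v0 $
    (Rec _ Nat $ Zero _ $ Lam (Lam (TAdd _ $ (Succ _ $ v1) $ v0)) $
       (TAdd _ $ v0 $ v1)))).

Lemma eval_pair G rho m n : eval (TPair G) rho m n = Cantor.to_nat (m, n).
Proof.
rewrite /= !eval_add /Cantor.to_nat plusE; congr (_ + _)%N.
by elim: (n + m)%N => //= k ->; rewrite eval_add.
Qed.
Opaque TPair.
Arguments Cantor.to_nat : simpl never.

(** The candidate advances as long as [f] vanishes at it. The result is the least [r <= n] with
    [f r] nonzero, and [n] if there is none. *)
Definition search (f : nat -> nat) (n : nat) : nat :=
  iteri n (fun i r => if f r == 0%N then i.+1 else r) 0%N.

Lemma search_le f n : (search f n <= n)%N.
Proof. by rewrite /search; elim: n => //= n IHn; case: ifP; lia. Qed.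

Lemma searchP f n i : (i <= n)%N -> f i != 0%N -> f (search f n) != 0%N.
Proof.
move=> lein fi; pose r := search f n.
(* Invariant: either the search has succeeded, or it has reached the bound and met only zeros before
   it. *)
suff [//|gtnr] : f r != 0%N \/ (n <= r)%N /\ forall j, (j < r)%N -> f j = 0%N.
  have [ltir|] := ltnP i r; first by rewrite (gtnr.2 i ltir) in fi.
  by move=> leri; rewrite -/r (_ : r = i) //; apply/eqP; rewrite eqn_leq leri
    (leq_trans lein gtnr.1).
rewrite /r /search; elim: n {lein r} => [|n IHn /=]; first by right; split.
set r := iteri _ _ _ in IHn *; case: (f r =P 0%N) => [fr0|/eqP]; last by left.
case: IHn => [|[lenr IHn]]; first by rewrite fr0.
have r_n : r = n by apply/eqP; rewrite eqn_leq lenr (search_le f n).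
right; split=> // j; rewrite ltnS leq_eqVlt => /predU1P[->|]; first by rewrite -r_n.
by rewrite -r_n; exact: IHn.
Qed.

Definition TSearch G : term G (Arr Ty1 (Arr Nat Nat)) :=
  Lam (Lam (Rec _ Nat $ Zero _ $
    Lam (Lam (TCond _ $ (v3 $ v0) $ v0 $ (Succ _ $ v1))) $ v0)).

Lemma eval_search G rho f n : eval (TSearch G) rho f n = search f n.
Proof. by rewrite /search; elim: n => //= n ->; rewrite eval_cond. Qed.
Opaque TSearch.

(** Both components of a pair are at most its code, so bounded search inverts the pairing. Testing
    the result of the inner search amounts to a bounded existential quantifier over the second
    component. *)
Definition TFst G : term G (Arr Nat Nat) :=
  Lam (TSearch _ $
    Lam (TEq _ $ (TPair _ $ v0 $
                   (TSearch _ $ Lam (TEq _ $ (TPair _ $ v1 $ v0) $ v2) $ v1))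
             $ v1) $ v0).

Lemma to_nat_ge m n : (m <= Cantor.to_nat (m, n))%N /\ (n <= Cantor.to_nat (m, n))%N.
Proof. by have := Cantor.to_nat_non_decreasing m n; lia. Qed.

Lemma eval_fst G rho c : eval (TFst G) rho c = (Cantor.of_nat c).1.
Proof.
have := Cantor.cancel_to_of c; case: (Cantor.of_nat c) => m n tmn.
have [lem len] : (m <= c /\ n <= c)%N by rewrite -tmn; exact: to_nat_ge.
rewrite /= eval_search; set f := (X in search X c).
have f_neq0 a : f a != 0%N -> a = m.
  rewrite /f eval_eq eval_pair eqb0 negbK -[in X in _ == X]tmn => /eqP E.
  by case: (Cantor.to_nat_inj _ _ E).
apply/f_neq0/(searchP lem).
rewrite /f eval_eq eval_pair eval_search; set h := (X in search X c).
have hE b : h b = (Cantor.to_nat (m, b) == c) by rewrite /h eval_eq eval_pair.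
by rewrite -hE; apply: (searchP len); rewrite hE tmn eqxx.
Qed.
Opaque TFst.

Definition TSnd G : term G (Arr Nat Nat) :=
  Lam (TSearch _ $ Lam (TEq _ $ (TPair _ $ (TFst _ $ v1) $ v0) $ v1) $ v0).

Lemma eval_snd G rho c : eval (TSnd G) rho c = (Cantor.of_nat c).2.
Proof.
rewrite /= eval_search; set f := (X in search X c).
have fE b : f b = (Cantor.to_nat ((Cantor.of_nat c).1, b) == c).
  by rewrite /f eval_eq eval_pair eval_fst.
have := Cantor.cancel_to_of c; case: (Cantor.of_nat c) fE => [m n] /= fE tmn.
have : f (search f c) != 0%N.
  have lenc : (n <= c)%N by rewrite -tmn; exact: (to_nat_ge m n).2.
  by apply: (searchP lenc); rewrite fE tmn eqxx.
rewrite fE eqb0 negbK -[in X in _ == X]tmn => /eqP E.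
by case: (Cantor.to_nat_inj _ _ E).
Qed.
Opaque TSnd.

Definition TEven G : term G (Arr Nat Nat) :=
  Lam (Rec _ Nat $ numeral _ 1 $ Lam (Lam (TSub _ $ numeral _ 1 $ v0)) $ v0).

Lemma eval_even G rho n : eval (TEven G) rho n = ~~ odd n.
Proof.
by elim: n => //= n ->; rewrite eval_sub eval_numeral; case: odd.
Qed.
Opaque TEven.

Definition THalf G : term G (Arr Nat Nat) :=
  Lam (Rec _ Nat $ Zero _ $
    Lam (Lam (TAdd _ $ (TSub _ $ numeral _ 1 $ (TEven _ $ v1)) $ v0)) $ v0).

Lemma eval_half G rho n : eval (THalf G) rho n = n./2.
Proof.
elim: n => [//|n /= ->].
rewrite eval_add eval_sub eval_numeral eval_even uphalf_half.
by case: odd.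
Qed.
Opaque THalf.

(** * Coverings of the unit interval *)

Lemma unit_interval_not_covered (R : realType) (c : nat -> R) :
  ~ `[0, 1]%classic `<=` \bigcup_m ball (c m) (2 ^- (m + 3)).
Proof.
move=> sub; pose B m : set R := ball (c m) (2 ^- (m + 3)).
have mu1 : lebesgue_measure (`[0, 1]%classic : set R) = 1%:E.
  by rewrite lebesgue_measure_itv /= lte_fin ltr01 oppr0 adde0.
have : (1%:E <= \sum_(0 <= m <oo) lebesgue_measure (B m))%E.
  rewrite -mu1; apply: measure_sigma_subadditive => // m.
  exact: measurable_realfun.measurable_ball.
rewrite leNgt => /negP; apply; apply: (@le_lt_trans _ _ (2^-1)%:E); last first.
  by rewrite lte_fin invf_lt1 ?ltr1n.
(* The [m]-th ball has measure 2 * 2^-(m+3) = (1/2) / 2^(m+1), and these sum to at most 1/2. *)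
apply: le_trans (epsilon_trick0 xpredT _); last by rewrite invr_ge0.
apply: lee_nneseries => // m _; rewrite lebesgue_measure_ball//.
rewrite lee_fin exprD natrX [2 ^+ m.+1]exprS.
rewrite le_eqVlt; apply/orP; left; apply/eqP.
by field; rewrite expf_neq0.
Qed.

(** By the triangle inequality, the balls of all indices of value [m] lie in the ball of radius
    2^-(m+3) about any one of their centres. Closeness will come from a failed search for NIN, and
    from injectivity for Cantor's theorem. *)
Lemma unit_interval_not_covered_by_classes (R : realType) (I : Type)
    (P : I -> Prop) (p : I -> R) (v : I -> nat) :
  (forall i j, P i -> P j -> v i = v j -> `|p i - p j| <= 2 ^- (v i + 4)) ->
  ~ `[0, 1]%classic `<=` \bigcup_(i in P) ball (p i) (2 ^- (v i + 4)).
Proof.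
move=> close sub.
(* One centre is chosen for each value that occurs, and 0 for the other values. *)
have [c cP] : exists c : nat -> R, forall i, P i ->
    exists j, [/\ P j, v j = v i & c (v i) = p j].
  suff /choice[c cP] : forall m, exists r : R, forall i, P i -> v i = m ->
      exists j, [/\ P j, v j = m & r = p j] by exists c => i Pi; exact: (cP _ _ Pi erefl).
  move=> m; have [[j [Pj vj]]|nex] := pselect (exists j, P j /\ v j = m).
    by exists (p j) => i _ _; exists j.
  by exists 0 => i Pi vi; case: nex; exists i.
apply: (@unit_interval_not_covered R c) => r /sub[i Pi].
rewrite -ball_normE /= => ri; exists (v i) => //=.
have [j [Pj vji ->]] := cP i Pi.
have -> : 2 ^- (v i + 3) = 2 ^- (v i + 4) + 2 ^- (v i + 4) :> R.
  by rewrite (addnS _ 3) exprS; field; rewrite expf_neq0.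
by rewrite -(subrKA (p i)) (le_lt_trans (ler_normD _ _))// ler_ltD// -vji close.
Qed.

(** * Representations of reals *)

Section Representations.
Variable R : realType.

(** The bound of [fast_cauchy] passes to the limit, where it becomes non-strict. *)
Lemma represents_dist (x : type1) (r : R) n :
  represents x r -> `|ratr (rat_of_code (x n)) - r| <= 2 ^- n.
Proof.
move=> [cx xr].
have : `|ratr (rat_of_code (x n)) - ratr (rat_of_code (x k))| @[k --> \oo] -->
    `|ratr (rat_of_code (x n)) - r|.
  by apply: cvg_norm; apply: cvgB => //; exact: cvg_cst.
move=> /cvgr_to_le; apply; near=> k.
have nk : (n <= k)%N by near: k; exact: nbhs_infty_ge.
rewrite -rmorphB -ratr_norm -[2 ^- n](_ : ratr (2 ^- n) = _).
  by rewrite ler_rat ltW // -(subnKC nk).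
by rewrite fmorphV rmorphXn /= rmorph_nat.
Unshelve. all: by end_near. Qed.

(** The even numerator code 2 stands for 1, and denominators are stored minus one. *)
Definition dyadic_code (n : nat) : nat := Cantor.to_nat (2, (2 ^ n).-1)%N.

Lemma rat_of_dyadic_code n : rat_of_code (dyadic_code n) = 2 ^- n.
Proof.
rewrite /rat_of_code /dyadic_code Cantor.cancel_of_to /= mul1r.
by rewrite prednK ?expn_gt0// natrX.
Qed.

Lemma represents_dyadic n : represents (fun=> dyadic_code n) (2 ^- n : R).
Proof.
split=> [m i|]; first by rewrite subrr normr0 invr_gt0 exprn_gt0.
rewrite rat_of_dyadic_code fmorphV rmorphXn /= rmorph_nat.
exact: cvg_cst.
Qed.

(* A code of a negative rational is read as 0: this does not increase the
   distance to a nonnegative real, and spares the sign. *)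
Definition num_code (c : nat) : nat :=
  ((Cantor.of_nat c).1./2 * ~~ odd (Cantor.of_nat c).1)%N.
Definition den_code (c : nat) : nat := (Cantor.of_nat c).2.+1.
Definition pos_of_code (c : nat) : R := (num_code c)%:R / (den_code c)%:R.

Lemma pos_of_code_dist c (r : R) : 0 <= r ->
  `|pos_of_code c - r| <= `|ratr (rat_of_code c) - r|.
Proof.
move=> r0; rewrite /pos_of_code /num_code /den_code /rat_of_code.
case: (Cantor.of_nat c) => m n /=; case: ifP => om; last first.
  by rewrite muln1 fmorph_div /= !rmorph_nat.
rewrite muln0 mul0r sub0r normrN ger0_norm// fmorph_div rmorphN /= !rmorph_nat.
have : 0 <= (uphalf m)%:R / n.+1%:R :> R by rewrite divr_ge0.
by move=> q0; rewrite mulNr -opprD normrN ger0_norm ?addr_ge0// lerDr.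
Qed.

(** The inequality a/u - b/v > 2 * 2^-n with denominators cleared, decided by truncated
    subtraction. *)
Definition code_gap (n c d : nat) : nat :=
  (num_code c * den_code d * 2 ^ n -
   (num_code d * den_code c * 2 ^ n + 2 * (den_code c * den_code d)))%N.

Lemma code_gap_neq0 n c d :
  (code_gap n c d != 0)%N = (2 * 2 ^- n < pos_of_code c - pos_of_code d).
Proof.
rewrite /code_gap /pos_of_code subn_eq0 -ltnNge -(ltr_nat R).
have : 0 < (den_code c)%:R :> R by rewrite ltr0n.
have : 0 < (den_code d)%:R :> R by rewrite ltr0n.
move: (num_code c) (num_code d) (den_code c) (den_code d) => a b u v v0 u0.
have n0 : 0 < 2 ^+ n :> R by rewrite exprn_gt0.
rewrite natrD !natrM natrX -[in RHS](ltr_pM2r (mulr_gt0 (mulr_gt0 u0 v0) n0)).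
by rewrite -ltrBrDl; congr (_ < _); field; rewrite ?gt_eqF.
Qed.

(** Each approximation errs by at most 2^-n. A gap above 2 * 2^-n thus certifies the strict order,
    and a smaller one leaves a difference of at most 4 * 2^-n. *)
Lemma code_gapP n x y (r s : R) : 0 <= r -> 0 <= s ->
  represents x r -> represents y s ->
  (code_gap n (x n) (y n) != 0%N -> s < r) /\
  (code_gap n (x n) (y n) = 0%N -> r - s <= 2 ^- n *+ 4).
Proof.
move=> r0 s0 xr ys.
have := le_trans (pos_of_code_dist (x n) r0) (represents_dist n xr).
have := le_trans (pos_of_code_dist (y n) s0) (represents_dist n ys).
rewrite !ler_norml => /andP[a1 a2] /andP[b1 b2].
split=> [|/eqP]; first by rewrite code_gap_neq0; lra.
apply: contraTT; rewrite code_gap_neq0; lra.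
Qed.

End Representations.

(** * Baire classes *)

(** To the [n]-th approximation is added a tent of half-width 1/n at [c], scaled to give the value
    [v] there. At any other point the tents are eventually 0. *)
Lemma baire_class1_update (R : realType) (f : R -> R) (c v : R) :
  baire_class 1 f -> baire_class 1 (fun r => if r == c then v else f r).
Proof.
move=> [h [hc hf]].
pose bump n (r : R) : R := Num.max 0 (1 - n%:R * `|r - c|).
exists (fun n r => h n r + (v - h n c) * bump n r); split=> [n|r r01].
  apply: within_continuousD; first exact: hc.
  apply: continuous_subspaceT => r; apply: cvgM; first exact: cvg_cst.
  apply: (@continuous_max R R (fun=> 0) (fun x => 1 - n%:R * `|x - c|)); first exact: cvg_cst.
  apply: cvgB; first exact: cvg_cst.
  apply: cvgM; first exact: cvg_cst.
  by apply: cvg_norm; apply: cvgB => //; exact: cvg_cst.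
case: eqP => [->|/eqP rc].
  apply: cvg_near_cst; near=> n.
  by rewrite /bump subrr normr0 mulr0 subr0 max_r// mulr1 subrKC.
rewrite -[f r]addr0; apply: cvgD; first exact: hf.
apply: cvg_near_cst; near=> n.
have d0 : 0 < `|r - c| by rewrite normr_gt0 subr_eq0.
rewrite /bump max_l ?mulr0// subr_le0 -ler_pdivrMr// div1r.
by near: n; exact: nbhs_infty_ger.
Unshelve. all: by end_near. Qed.

(** Cutting off at [g r < k] leaves at most [k] exceptional points by injectivity, so the cut-off
    function is obtained from a constant by finitely many updates. At each point the cut-offs are
    eventually constant in [k]. *)
Lemma baire_class2_countable (R : realType) (A : set R) (g : R -> nat)
    (w : nat -> R) (a : R) :
  (forall r s, A r -> A s -> g r = g s -> r = s) ->
  baire_class 2 (fun r => if r \in A then w (g r) else a).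
Proof.
move=> inj; exists (fun k r => if (r \in A) && (g r < k)%N then w (g r) else a).
split=> [k|r r01]; last first.
  apply: cvg_near_cst; near=> k; case: (r \in A) => //=.
  by rewrite ifT//; near: k; exact: nbhs_infty_gt.
elim: k => [|k IHk].
  exists (fun _ _ => a); split=> [_|r _].
    by apply: continuous_subspaceT => r; exact: cvg_cst.
  by rewrite ltn0 andbF; exact: cvg_cst.
(* Raising the cut-off from [k] to [k.+1] updates the only point of value [k], or changes
   nothing. *)
have [[c [Ac gc]]|nex] := pselect (exists c, A c /\ g c = k).
  rewrite [X in baire_class 1 X](_ : _ = (fun r => if r == c then w k else
      if (r \in A) && (g r < k)%N then w (g r) else a)).
    exact: baire_class1_update.
  apply/funext => r; case: eqP => [->|rc]; first by rewrite mem_set//= gc ltnSn.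
  case: (boolP (r \in A)) => //= /set_mem Ar.
  rewrite ltnS leq_eqVlt; case: eqP => //= gr.
  by case: rc; apply: inj => //; rewrite gc.
rewrite [X in baire_class 1 X](_ : _ = (fun r =>
    if (r \in A) && (g r < k)%N then w (g r) else a)) //.
apply/funext => r; case: (boolP (r \in A)) => //= /set_mem Ar.
by rewrite ltnS leq_eqVlt; case: eqP => //= gr; case: nex; exists r.
Unshelve. all: by end_near. Qed.

(** * The reductions *)

Definition point (w : type1) (i : nat) : type1 :=
  fun n => w (Cantor.to_nat (i, n)).+1.

Definition TPoint G : term G (Arr Ty1 (Arr Nat Ty1)) :=
  Lam (Lam (Lam (v2 $ (Succ _ $ (TPair _ $ v1 $ v0))))).

Lemma eval_point G rho w i : eval (TPoint G) rho w i = point w i.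
Proof. by apply/funext => n; rewrite /= eval_pair. Qed.
Opaque TPoint.

Definition TCons G : term G (Arr Nat (Arr Ty1 Ty1)) :=
  Lam (Lam (Lam (Rec _ Nat $ v2 $ Lam (Lam (v3 $ v1)) $ v0))).

Lemma eval_cons G rho n x : eval (TCons G) rho n x = cons_fun n x.
Proof. by apply/funext => -[]. Qed.
Opaque TCons.

Definition TDyadic G : term G (Arr Nat Nat) :=
  Lam (TPair _ $ numeral _ 2 $ (TPred _ $ (TExp2 _ $ v0))).

Lemma eval_dyadic G rho n : eval (TDyadic G) rho n = dyadic_code n.
Proof. by rewrite /= eval_numeral eval_exp2 eval_pred eval_pair. Qed.
Opaque TDyadic.

Definition TNum G : term G (Arr Nat Nat) :=
  Lam (TMul _ $ (THalf _ $ (TFst _ $ v0)) $ (TEven _ $ (TFst _ $ v0))).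

Lemma eval_num G rho c : eval (TNum G) rho c = num_code c.
Proof. by rewrite /= eval_mul eval_half eval_even eval_fst. Qed.
Opaque TNum.

Definition TDen G : term G (Arr Nat Nat) := Lam (Succ _ $ (TSnd _ $ v0)).

Lemma eval_den G rho c : eval (TDen G) rho c = den_code c.
Proof. by rewrite /= eval_snd. Qed.
Opaque TDen.

Definition TGap G : term G (Arr Nat (Arr Nat (Arr Nat Nat))) :=
  Lam (Lam (Lam (TSub _ $
    (TMul _ $ (TMul _ $ (TNum _ $ v1) $ (TDen _ $ v0)) $ (TExp2 _ $ v2)) $
    (TAdd _ $
      (TMul _ $ (TMul _ $ (TNum _ $ v0) $ (TDen _ $ v1)) $ (TExp2 _ $ v2)) $
      (TMul _ $ numeral _ 2 $ (TMul _ $ (TDen _ $ v1) $ (TDen _ $ v0))))))).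

Lemma eval_gap G rho n c d : eval (TGap G) rho n c d = code_gap n c d.
Proof.
rewrite /= eval_sub eval_add !eval_mul eval_numeral eval_exp2.
by rewrite !eval_num !eval_den.
Qed.
Opaque TGap.

(** * Finding two distinct points of a cover with the same value *)

Section NIN.

(** The inner [Lam] drops the index put in front of the argument by [codes_real_fun]. The output
    does not depend on that index, because a constant sequence represents a dyadic radius. *)
Definition radius_term : term [::] (Arr Ty2 Ty2) :=
  Lam (Lam (TDyadic _ $
    (TAdd _ $ (v1 $ Lam (v1 $ (Succ _ $ v0))) $ numeral _ 4))).

Lemma section_radius (Z : type2) n x :
  section (interp radius_term Z) n x = dyadic_code (Z x + 4).
Proof. by rewrite /section /interp /= eval_dyadic eval_add eval_numeral. Qed.

Variables (Z : type2) (w : type1).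

(* Approximations within 2^-(m+6) of the points: when their gap is at most
   2 * 2^-(m+6), the points are within 4 * 2^-(m+6) = 2^-(m+4). *)
Definition precision (i : nat) : nat := (Z (point w i) + 6)%N.

(** The product acts as a conjunction. The gap is one-sided, so a clash of [i] with [j] certifies
    that point [i] is the larger one. *)
Definition clash (i j : nat) : nat :=
  ((Z (point w i) == Z (point w j)) *
   code_gap (precision i) (point w i (precision i)) (point w j (precision i)))%N.

Definition clash_left : nat :=
  search (fun i => clash i (search (clash i) (w 0%N))) (w 0%N).

Definition clash_right : nat := search (clash clash_left) (w 0%N).

Lemma clash_searchP i j : (i <= w 0)%N -> (j <= w 0)%N -> clash i j != 0%N ->
  clash clash_left clash_right != 0%N.
Proof.
move=> lei lej cij; rewrite /clash_right {1}/clash_left.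
exact: (searchP (f := fun i => clash i (search (clash i) (w 0%N))) lei
  (searchP lej cij)).
Qed.

End NIN.

Definition TPrecision G : term G (Arr Ty2 (Arr Ty1 (Arr Nat Nat))) :=
  Lam (Lam (Lam (TAdd _ $ (v2 $ (TPoint _ $ v1 $ v0)) $ numeral _ 6))).

Lemma eval_precision G rho Z w i :
  eval (TPrecision G) rho Z w i = precision Z w i.
Proof. by rewrite /= eval_add eval_numeral eval_point. Qed.
Opaque TPrecision.

Definition TClash G : term G (Arr Ty2 (Arr Ty1 (Arr Nat Ty1))) :=
  Lam (Lam (Lam (Lam (TMul _ $
    (TEq _ $ (v3 $ (TPoint _ $ v2 $ v1)) $ (v3 $ (TPoint _ $ v2 $ v0))) $
    (TGap _ $ (TPrecision _ $ v3 $ v2 $ v1) $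
      (TPoint _ $ v2 $ v1 $ (TPrecision _ $ v3 $ v2 $ v1)) $
      (TPoint _ $ v2 $ v0 $ (TPrecision _ $ v3 $ v2 $ v1))))))).

Lemma eval_clash G rho Z w i : eval (TClash G) rho Z w i = clash Z w i.
Proof.
apply/funext => j.
by rewrite /= eval_mul eval_eq eval_gap eval_precision !eval_point.
Qed.
Opaque TClash.

Definition TLeft G : term G (Arr Ty2 (Arr Ty1 Nat)) :=
  Lam (Lam (TSearch _ $
    Lam (TClash _ $ v2 $ v1 $ v0 $
      (TSearch _ $ (TClash _ $ v2 $ v1 $ v0) $ (v1 $ Zero _))) $
    (v0 $ Zero _))).

Lemma eval_left G rho Z w : eval (TLeft G) rho Z w = clash_left Z w.
Proof.
rewrite /= eval_search; congr search; apply/funext => i.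
by rewrite eval_search !eval_clash.
Qed.
Opaque TLeft.

Definition TRight G : term G (Arr Ty2 (Arr Ty1 Nat)) :=
  Lam (Lam (TSearch _ $ (TClash _ $ v1 $ v0 $ (TLeft _ $ v1 $ v0)) $
    (v0 $ Zero _))).

Lemma eval_right G rho Z w : eval (TRight G) rho Z w = clash_right Z w.
Proof. by rewrite /= eval_search eval_left eval_clash. Qed.
Opaque TRight.

Definition clash_term : term [::] (Arr Ty2 (Arr Ty1 Ty1)) :=
  Lam (Lam (Lam (TCond _ $ (TEven _ $ v0) $
    (TPoint _ $ v1 $ (TLeft _ $ v2 $ v1) $ (THalf _ $ v0)) $
    (TPoint _ $ v1 $ (TRight _ $ v2 $ v1) $ (THalf _ $ v0))))).

Lemma interp_clash Z w n : interp clash_term Z w n =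
  point w (if odd n then clash_right Z w else clash_left Z w) n./2.
Proof.
rewrite /interp /= eval_cond eval_even !eval_half eval_left eval_right.
by rewrite !eval_point; case: odd.
Qed.

Lemma NIN_reduces_to_HBU (R : realType) : N_reduces (NIN R) (HBU R).
Proof.
exists (pickle copy_program), clash_term, radius_term => Z w hbu.
exists (interp clash_term Z w); split=> [n|g gZ]; first exact: computes_copy.
have [] := hbu (fun r => 2 ^- (g r + 4)).
- move=> x r r01 xr; rewrite (_ : (fun n => _) = fun=> dyadic_code (g r + 4)).
    exact: represents_dyadic.
  by apply/funext => n; rewrite section_radius (gZ x r).
- by move=> r _; rewrite invr_gt0 exprn_gt0.
move=> k [p [[w0 wp] p01 cov]].
have pge0 i : (i <= k)%N -> 0 <= p i by move/p01; rewrite in_itv /= => /andP[].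
(* Since [Z] respects representations, the values compared by the search are those of [g] at the
   real points. *)
have Zp i : (i <= k)%N -> Z (point w i) = g (p i).
  by move=> ik; apply: gZ; [exact: p01|exact: wp].
have [[i [j [ik jk cij]]]|nclash] :=
    pselect (exists i j, [/\ (i <= k)%N, (j <= k)%N & clash Z w i j != 0%N]).
  have lk : (clash_left Z w <= k)%N by rewrite -w0; exact: search_le.
  have rk : (clash_right Z w <= k)%N by rewrite -w0; exact: search_le.
  rewrite -w0 in ik jk; have := clash_searchP ik jk cij.
  rewrite /clash muln_eq0 negb_or eqb0 negbK !Zp// => /andP[/eqP gE gap].
  exists (p (clash_left Z w)), (p (clash_right Z w)); split=> //.
  - split.
      rewrite (_ : (fun n => _) = point w (clash_left Z w)); first exact: wp.
      by apply/funext => n; rewrite interp_clash odd_double doubleK.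
    rewrite (_ : (fun n => _) = point w (clash_right Z w)); first exact: wp.
    by apply/funext => n; rewrite interp_clash /= odd_double /= uphalf_double.
  - exact: p01.
  - exact: p01.
  - have [lt_p _] := code_gapP (precision Z w (clash_left Z w))
      (pge0 _ lk) (pge0 _ rk) (wp _ lk) (wp _ rk).
    by move=> E; have := lt_p gap; rewrite E ltxx.
exfalso; apply: (unit_interval_not_covered_by_classes
  (P := [set i | (i <= k)%N]) (p := p) (v := g \o p)) cov => i j /= ik jk gE.
(* The absence of a clash bounds the difference from one side only. Exchanging [i] and [j] gives the
   other side. *)
wlog suff half : i j ik jk gE / p i - p j <= 2 ^- (g (p i) + 4).
  rewrite ler_norml half// andbT lerNl opprB gE; exact: half.
have : clash Z w i j = 0%N.
  by apply/eqP/negPn/negP => cij; apply: nclash; exists i, j.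
rewrite /clash !Zp// gE eqxx mul1n => gap0.
have [_ /(_ gap0)/le_trans-> //] := code_gapP (precision Z w i)
      (pge0 _ ik) (pge0 _ jk) (wp _ ik) (wp _ jk).
rewrite /precision Zp// gE !exprD le_eqVlt; apply/orP; left; apply/eqP.
by field; rewrite expf_neq0.
Qed.

(** * Finding a point of a cover outside the set *)

Definition set_radius_term : term [::] (Arr Ty2 Ty2) :=
  Lam (Lam (TDyadic _ $ (TCond _ $
    (v1 $ (TCons _ $ Zero _ $ Lam (v1 $ (Succ _ $ v0)))) $
    (TAdd _ $ (v1 $ (TCons _ $ numeral _ 1 $ Lam (v1 $ (Succ _ $ v0)))) $
       numeral _ 4) $
    Zero _))).

(** The case distinction is made on the exponent: off the set it is 0, which gives the radius 1 =
    2^-0, so both cases are dyadic. *)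
Lemma section_set_radius (Z : type2) n x :
  section (interp set_radius_term Z) n x = dyadic_code
    (if section Z 0 x == 0%N then 0 else section Z 1 x + 4)%N.
Proof.
rewrite /section /interp /= eval_dyadic eval_cond eval_add !eval_numeral.
by rewrite !eval_cons.
Qed.

Definition outside (Z : type2) (w : type1) : nat -> nat :=
  fun i => section Z 0 (point w i) == 0%N.

Definition outside_term : term [::] (Arr Ty2 (Arr Ty1 Ty1)) :=
  Lam (Lam (TPoint _ $ v0 $
    (TSearch _ $
      Lam (TEq _ $ (v2 $ (TCons _ $ Zero _ $ (TPoint _ $ v1 $ v0))) $ Zero _) $
      (v0 $ Zero _)))).

Lemma interp_outside Z w :
  interp outside_term Z w = point w (search (outside Z w) (w 0%N)).
Proof.
rewrite /interp /= eval_point eval_search; congr (point w (search _ _)).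
by apply/funext => i; rewrite eval_eq eval_cons eval_point.
Qed.

Lemma Cantor_thm_reduces_to_HBU_Baire2 (R : realType) :
  N_reduces (Cantor_thm R) (HBU_Baire2 R).
Proof.
exists (pickle copy_program), outside_term, set_radius_term => Z w hbu.
exists (interp outside_term Z w); split=> [n|A g _ AZ gZ inj].
  exact: computes_copy.
have [] := hbu (fun r => if r \in A then 2 ^- (g r + 4) else 1).
- move=> x r r01 xr; rewrite (_ : (fun n => _) =
      fun=> dyadic_code (if r \in A then g r + 4 else 0)).
    case: ifP => _; first exact: represents_dyadic.
    by rewrite -[1]invr1 -(expr0 2); exact: represents_dyadic.
  apply/funext => n; rewrite section_set_radius (AZ x r)// (gZ x r)//.
  by case: (r \in A).
- by move=> r _; case: ifP => // _; rewrite invr_gt0 exprn_gt0.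
- exact: (baire_class2_countable (fun m => 2 ^- (m + 4))).
move=> k [p [[w0 wp] p01 cov]].
have outE i : (i <= k)%N -> outside Z w i = (p i \notin A).
  move=> ik; rewrite /outside (AZ _ (p i)) ?eqb0//; first exact: p01.
  exact: wp.
set i0 := search (outside Z w) (w 0%N).
have i0k : (i0 <= k)%N by rewrite -w0; exact: search_le.
exists (p i0); split; first by rewrite interp_outside; exact: wp.
  exact: p01.
suff : outside Z w i0 != 0%N.
  by rewrite outE// eqb0 negbK => /negP pA /mem_set.
have [[i [ik out]]|allA] := pselect (exists i, (i <= k)%N /\ ~ A (p i)).
  apply: (@searchP _ _ i); first by rewrite w0.
  by rewrite outE// eqb0 negbK; apply/negP => /set_mem.
have pA i : (i <= k)%N -> A (p i).
  by move=> ik; apply: contrapT => nA; apply: allA; exists i.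
(* If all points of the cover lie in [A], those with equal values coincide and are at distance 0. *)
exfalso; apply: (unit_interval_not_covered_by_classes
  (P := [set i | (i <= k)%N]) (p := p) (v := g \o p)) => [i j /= ik jk gE|].
  by rewrite (inj (p i) (p j)) ?subrr ?normr0 ?invr_ge0 ?exprn_ge0//; exact: pA.
move=> r /cov[i /= ik]; rewrite mem_set; last exact: pA.
by exists i.
Qed.

Theorem theorem4 (R : realType) :
  N_reduces (NIN R) (HBU R) /\ N_reduces (Cantor_thm R) (HBU_Baire2 R).
Proof.
split; [exact: NIN_reduces_to_HBU|exact: Cantor_thm_reduces_to_HBU_Baire2].
Qed.
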